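(* Let $\varphi$ and $\psi$ be structural sets in $\mathbb{R}^m$, let $\Omega\subset\mathbb{R}^m$ be a domain, and let $f\in C^2(\Omega)$ be an $\mathbb{R}_{0,m}$-valued function which is harmonic in $\Omega$. Then the functions ${}^{\varphi,\psi}\Psi_+(f)$ and ${}^{\varphi,\psi}\Psi_-(f)$ are both harmonic and $(\varphi,\psi)$-inframonogenic in $\Omega$.
   Context: $\mathbb{R}_{0,m}$ is the real Clifford algebra (of dimension $2^m$) generated by the standard basis $e_1,\dots,e_m$ of $\mathbb{R}^m$ with $e_ie_j+e_je_i=-2\delta_{ij}$; $\mathbb{R}^m$ is regarded as the subspace spanned by $e_1,\dots,e_m$. A structural set is an (ordered) orthonormal basis $\psi=\{\psi^1,\dots,\psi^m\}$ of $\mathbb{R}^m$; thus $\psi^i\psi^j+\psi^j\psi^i=-2\delta_{ij}$. Reversion $a\mapsto\widehat{a}$ is the real linear anti-automorphism of $\mathbb{R}_{0,m}$ with $\widehat{e_i}=e_i$. For $A=\{j_1<\cdots<j_k\}\subset\{1,\dots,m\}$ put $\varphi_A=\varphi^{j_1}\cdots\varphi^{j_k}$, $\psi_A=\psi^{j_1}\cdots\psi^{j_k}$. For $k=1,\dots,m$ define ${}^{\varphi,\psi}\Psi_k(a)=\sum_{|A|=k}\varphi_A\,a\,\widehat{\psi_A}$ for $a\in\mathbb{R}_{0,m}$, and ${}^{\varphi,\psi}\Psi_0=I$ (the identity). Define ${}^{\varphi,\psi}\Psi_+(a)=\sum_{k\ \mathrm{even}}{}^{\varphi,\psi}\Psi_k(a)$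 and ${}^{\varphi,\psi}\Psi_-(a)=\sum_{k\ \mathrm{odd}}{}^{\varphi,\psi}\Psi_k(a)$, with sums over $0\le k\le m$. These operators act pointwise on $\mathbb{R}_{0,m}$-valued functions. A domain is an open connected set. Differentiability of $\mathbb{R}_{0,m}$-valued functions is component-wise. A $C^2$ function $f:\Omega\to\mathbb{R}_{0,m}$ is harmonic if $\Delta f=0$ in $\Omega$ ($\Delta=\sum_i\partial^2/\partial x_i^2$), and $(\varphi,\psi)$-inframonogenic if ${}^{\varphi}\underline{\partial}[f]\,{}^{\psi}\underline{\partial}=\sum_{i,j=1}^m\varphi^i\frac{\partial^2 f}{\partial x_i\partial x_j}\psi^j=0$ in $\Omega$. *)

(* Defs.v *)
From HB Require Import structures.
From mathcomp Require Import all_boot all_order all_algebra.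
From mathcomp Require Import all_classical all_reals all_analysis.
From mathcomp Require Import ring.

Set Implicit Arguments.
Unset Strict Implicit.
Unset Printing Implicit Defensive.

Import Order.TTheory GRing.Theory Num.Theory.
Import numFieldNormedType.Exports.

Local Open Scope classical_set_scope.
Local Open Scope ring_scope.

Definition symdiff (T : finType) (A B : {set T}) : {set T} :=
  (A :\: B) :|: (B :\: A).

Section SymDiff.
Variable T : finType.
Implicit Types A B C : {set T}.

Lemma in_symdiff A B x : (x \in symdiff A B) = (x \in A) (+) (x \in B).
Proof. by rewrite !inE; case: (x \in A); case: (x \in B). Qed.

Lemma symdiffC A B : symdiff A B = symdiff B A.
Proof. by apply/setP => x; rewrite !in_symdiff addbC. Qed.

Lemma symdiffA A B C : symdiff A (symdiff B C) = symdiff (symdiff A B) C.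
Proof. by apply/setP => x; rewrite !in_symdiff addbA. Qed.

Lemma symdiff0 A : symdiff A finset.set0 = A.
Proof. by apply/setP => x; rewrite in_symdiff inE addbF. Qed.

Lemma symdiffK A B : symdiff A (symdiff A B) = B.
Proof. by apply/setP => x; rewrite !in_symdiff addbA addbb. Qed.

Lemma symdiffv A : symdiff A A = finset.set0.
Proof. by apply/setP => x; rewrite in_symdiff inE addbb. Qed.

Lemma prod_symdiff (R : comNzRingType) (g : T -> R) A B :
  (forall x, g x * g x = 1) ->
  \prod_(x in symdiff A B) g x = (\prod_(x in A) g x) * (\prod_(x in B) g x).
Proof.
move=> gg; rewrite !(big_mkcond (fun x => x \in _)) -big_split /=.
apply: eq_bigr => x _; rewrite in_symdiff.
by case: (x \in A); case: (x \in B); rewrite /= ?gg ?mulr1 ?mul1r.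
Qed.

End SymDiff.

(* An element of R_{0,m} is the family of its coordinates in the basis (e_A), where
   e_A = e_{j_1} ... e_{j_k} for A = {j_1 < ... < j_k}. *)

Definition clifford (R : comNzRingType) (m : nat) : Type :=
  {ffun {set 'I_m} -> R}.

HB.instance Definition _ (R : comNzRingType) (m : nat) :=
  GRing.Lmodule.copy (clifford R m) {ffun {set 'I_m} -> R^o}.

(* e_A e_B = cl_sign A B *: e_(symdiff A B): moving each e_j (j in B) to the
   left past the e_i (i in A) with j < i costs a factor -1 for each of them,
   and each e_i e_i (i in both A and B) contributes e_i ^+ 2 = -1. *)
Definition cl_sign {R : comNzRingType} {m : nat} (A B : {set 'I_m}) : R :=
  \prod_(i in A) \prod_(j in B | (j <= i)%N) -1.

Definition cl_mul {R : comNzRingType} {m : nat} (a b : clifford R m) :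
    clifford R m :=
  [ffun C => \sum_A cl_sign A (symdiff A C) * a A * b (symdiff A C)].

Definition cl_basis {R : comNzRingType} {m : nat} (A : {set 'I_m}) :
    clifford R m :=
  [ffun B => (B == A)%:R].

Section CliffordRing.
Variables (R : comNzRingType) (m : nat).
Implicit Types (a b c : clifford R m) (A B C D : {set 'I_m}).
Let sg A B : R := cl_sign A B.

Lemma cl_sign_prod A B :
  cl_sign A B = \prod_(i in A) \prod_(j in B) (if (j <= i)%N then -1 else 1 : R).
Proof. by apply: eq_bigr => i _; rewrite -big_mkcondr. Qed.

Let pm1K (b : bool) : (if b then -1 else 1 : R) * (if b then -1 else 1) = 1.
Proof. by case: b; rewrite ?mulrNN mulr1. Qed.

Lemma cl_signDl A B C : sg (symdiff A B) C = sg A C * sg B C.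
Proof.
rewrite /sg !cl_sign_prod prod_symdiff // => i.
by rewrite -big_split /= big1.
Qed.

Lemma cl_signDr A B C : sg A (symdiff B C) = sg A B * sg A C.
Proof.
rewrite /sg !cl_sign_prod -big_split /=; apply: eq_bigr => i _.
by rewrite prod_symdiff.
Qed.

Lemma cl_sign0l A : sg finset.set0 A = 1.
Proof. by rewrite /sg /cl_sign big_set0. Qed.

Lemma cl_sign0r A : sg A finset.set0 = 1.
Proof. by rewrite /sg cl_sign_prod big1 // => i _; rewrite big_set0. Qed.

Lemma cl_mulE a b C :
  cl_mul a b C = \sum_A sg A (symdiff A C) * a A * b (symdiff A C).
Proof. by rewrite ffunE. Qed.

Lemma cl_mulA : associative (@cl_mul R m).
Proof.
move=> a b c; apply/ffunP => D; rewrite !cl_mulE.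
under [RHS]eq_bigr => B _ do rewrite cl_mulE mulr_sumr mulr_suml.
rewrite exchange_big /=; apply: eq_bigr => A _.
rewrite cl_mulE mulr_sumr.
rewrite (reindex_inj (can_inj (symdiffK A))) /=; apply: eq_bigr => B _.
have -> : symdiff (symdiff A B) (symdiff A D) = symdiff B D.
  by apply/setP => x; rewrite !in_symdiff; do 3 case: (x \in _).
have -> : symdiff A D = symdiff (symdiff A B) (symdiff B D).
  by apply/setP => x; rewrite !in_symdiff; do 3 case: (x \in _).
set E := symdiff A B; set F := symdiff B D.
have -> : sg B F = sg A F * sg E F.
  by rewrite -cl_signDl /E symdiffK.
rewrite cl_signDr; ring.
Qed.

Lemma cl_mul1l : left_id (cl_basis finset.set0) (@cl_mul R m).
Proof.
move=> a; apply/ffunP => C; rewrite cl_mulE.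
rewrite (bigD1 finset.set0) //= big1 ?addr0.
  by rewrite symdiffC symdiff0 cl_sign0l ffunE eqxx !mul1r.
by move=> A /negPf A0; rewrite ffunE A0 mulr0 mul0r.
Qed.

Lemma cl_mul1r : right_id (cl_basis finset.set0) (@cl_mul R m).
Proof.
move=> a; apply/ffunP => C; rewrite cl_mulE (bigD1 C) //= big1 ?addr0.
  by rewrite symdiffv cl_sign0r ffunE eqxx mulr1 mul1r.
move=> A neAC; rewrite [cl_basis _ _]ffunE; case: eqP => [E|]; last by rewrite mulr0.
by move: neAC; rewrite -(symdiff0 A) -E symdiffK eqxx.
Qed.

Lemma cl_mulDl : left_distributive (@cl_mul R m) +%R.
Proof.
move=> a b c; apply/ffunP => C; rewrite cl_mulE [RHS]ffunE !cl_mulE -big_split /=.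
by apply: eq_bigr => A _; rewrite ffunE mulrDr mulrDl.
Qed.

Lemma cl_mulDr : right_distributive (@cl_mul R m) +%R.
Proof.
move=> a b c; apply/ffunP => C; rewrite cl_mulE [RHS]ffunE !cl_mulE -big_split /=.
by apply: eq_bigr => A _; rewrite ffunE mulrDr.
Qed.

Lemma cl_one_neq0 : cl_basis finset.set0 != 0 :> clifford R m.
Proof.
by apply/eqP => /ffunP /(_ finset.set0); rewrite !ffunE eqxx => /eqP; rewrite oner_eq0.
Qed.

HB.instance Definition _ := GRing.Zmodule_isNzRing.Build (clifford R m)
  cl_mulA cl_mul1l cl_mul1r cl_mulDl cl_mulDr cl_one_neq0.

Lemma cl_coefZ (k : R) a A : (k *: a) A = k * a A.
Proof. by rewrite ffunE. Qed.

Lemma cl_coefM a b C :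
  (a * b) C = \sum_A cl_sign A (symdiff A C) * a A * b (symdiff A C).
Proof. exact: cl_mulE. Qed.

Lemma cl_scaleAl (k : R) a b : k *: (a * b) = (k *: a) * b.
Proof.
apply/ffunP => C; rewrite cl_coefZ !cl_coefM mulr_sumr.
by apply: eq_bigr => A _; rewrite cl_coefZ mulrA [_ * (k * _)]mulrCA.
Qed.

HB.instance Definition _ :=
  GRing.Lmodule_isLalgebra.Build R (clifford R m) cl_scaleAl.

Lemma cl_scaleAr (k : R) a b : k *: (a * b) = a * (k *: b).
Proof.
apply/ffunP => C; rewrite cl_coefZ !cl_coefM mulr_sumr.
by apply: eq_bigr => A _; rewrite cl_coefZ mulrCA.
Qed.

HB.instance Definition _ :=
  GRing.Lalgebra_isAlgebra.Build R (clifford R m) cl_scaleAr.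

End CliffordRing.

Definition cl_e {R : comNzRingType} {m : nat} (i : 'I_m) : clifford R m :=
  cl_basis [set i]%SET.

Definition cl_vec {R : comNzRingType} {m : nat} (v : 'rV[R]_m) : clifford R m :=
  \sum_(i < m) v ord0 i *: cl_e i.

(* For A = {j_1 < ... < j_k}, [enum A] is j_1, ..., j_k in this order, so that
   e_{j_1} ... e_{j_k} is sent to e_{j_k} ... e_{j_1}; see [cl_basisE]. *)
Definition cl_reversion {R : comNzRingType} {m : nat} (a : clifford R m) :
    clifford R m :=
  \sum_(A : {set 'I_m}) a A *: \prod_(i <- rev (enum A)) cl_e i.

Section CliffordTheory.
Variables (R : comNzRingType) (m : nat).
Implicit Types (a b c : clifford R m) (A B C : {set 'I_m}).

Lemma cl_basis0 : cl_basis finset.set0 = 1 :> clifford R m.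
Proof. by []. Qed.

Lemma cl_basisM A B :
  cl_basis A * cl_basis B = cl_sign A B *: cl_basis (symdiff A B) :> clifford R m.
Proof.
apply/ffunP => C; rewrite cl_coefM cl_coefZ (bigD1 A) //= big1 ?addr0; last first.
  by move=> D /negPf DA; rewrite [cl_basis A D]ffunE DA mulr0 mul0r.
rewrite !ffunE eqxx mulr1.
have -> : (C == symdiff A B) = (symdiff A C == B).
  by apply/eqP/eqP => [->|<-]; rewrite symdiffK.
by case: eqP => [->|]; rewrite ?mulr0.
Qed.

Lemma cl_expand a : a = \sum_A a A *: cl_basis A.
Proof.
apply/ffunP => C; rewrite sum_ffunE (bigD1 C) //= big1 ?addr0.
  by rewrite cl_coefZ ffunE eqxx mulr1.
by move=> A /negPf neAC; rewrite cl_coefZ ffunE eq_sym neAC mulr0.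
Qed.

Lemma cl_sign11 (i j : 'I_m) :
  cl_sign [set i]%SET [set j]%SET = (if (j <= i)%N then -1 else 1) :> R.
Proof. by rewrite cl_sign_prod !big_set1. Qed.

Lemma cl_e_anticomm (i j : 'I_m) :
  cl_e i * cl_e j + cl_e j * cl_e i = (- 2 * (i == j)%:R)%:A :> clifford R m.
Proof.
rewrite /cl_e !cl_basisM (symdiffC [set j]%SET) -scalerDl !cl_sign11.
have [<-|ij] := eqVneq i j; first by rewrite leqnn symdiffv -opprD -mulr2n mulr1.
rewrite mulr0 scale0r; have := ij; rewrite -val_eqE /=.
by case: ltngtP => //= _ _; rewrite ?subrr ?addNr ?addrN scale0r.
Qed.

Let sorted_enum A : sorted ltn (map val (enum A)).
Proof.
have -> : enum A = [seq x <- enum 'I_m | x \in A] by rewrite enumT.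
rewrite sorted_map; apply: sorted_filter => [x y z /=|]; first exact: ltn_trans.
by rewrite -sorted_map val_enum_ord iota_ltn_sorted.
Qed.

Let path_cons (i : 'I_m) (s : seq 'I_m) : path ltn i (map val s) ->
  sorted ltn (map val s) /\ forall j, j \in [set k in s]%SET -> (i < j)%N.
Proof.
move=> ps; split; first exact: path_sorted ps.
move=> j; rewrite inE => js.
have /allP/(_ (val j)) := order_path_min ltn_trans ps.
by apply; rewrite map_f.
Qed.

Let symdiff_cons (i : 'I_m) (s : seq 'I_m) :
  (forall j, j \in [set k in s]%SET -> (i < j)%N) ->
  symdiff [set i]%SET [set k in s]%SET = [set k in i :: s]%SET.
Proof.
move=> is_; apply/setP => x; rewrite in_symdiff !inE; case: eqP => // -> /=.
by case: (boolP (i \in s)) => // ii; have := is_ i; rewrite inE ii ltnn => /(_ isT).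
Qed.

Let prod_sorted (s : seq 'I_m) : sorted ltn (map val s) ->
  \prod_(i <- s) cl_e i = cl_basis [set i in s]%SET :> clifford R m.
Proof.
elim: s => [_|i s IH /path_cons[ss is_]].
  by rewrite big_nil -cl_basis0; congr cl_basis; apply/setP => x; rewrite !inE.
rewrite big_cons IH // /cl_e cl_basisM symdiff_cons //.
rewrite cl_sign_prod big_set1 big1 ?scale1r // => j /is_ ij.
by rewrite leqNgt ij.
Qed.

Lemma cl_basisE A : cl_basis A = \prod_(i <- enum A) cl_e i :> clifford R m.
Proof.
by rewrite prod_sorted //; congr cl_basis; apply/setP => x; rewrite inE mem_enum.
Qed.

(* ls A A is the sign such that reversion maps e_A to ls A A *: e_A. *)
Let ls A B : R := \prod_(i in A) \prod_(j in B) (if (j < i)%N then -1 else 1).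
Let ds A B : R := \prod_(i in A) \prod_(j in B) (if i == j then -1 else 1).

Let pmK (b : bool) : (if b then -1 else 1 : R) * (if b then -1 else 1) = 1.
Proof. by case: b; rewrite ?mulrNN mulr1. Qed.

Let lsDl A B C : ls (symdiff A B) C = ls A C * ls B C.
Proof. by rewrite /ls prod_symdiff // => i; rewrite -big_split /= big1. Qed.

Let lsDr A B C : ls A (symdiff B C) = ls A B * ls A C.
Proof.
by rewrite /ls -big_split /=; apply: eq_bigr => i _; rewrite prod_symdiff.
Qed.

Let lsK A B : ls A B * ls A B = 1.
Proof.
by rewrite -lsDr symdiffv /ls big1 // => i _; rewrite big_set0.
Qed.

Let signE A B : cl_sign A B = ls A B * ds A B.
Proof.
rewrite cl_sign_prod -big_split /=; apply: eq_bigr => i _.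
rewrite -big_split /=; apply: eq_bigr => j _; rewrite -val_eqE /=.
by case: ltngtP; rewrite ?mulr1 ?mul1r.
Qed.

Let dsC A B : ds A B = ds B A.
Proof.
rewrite /ds exchange_big /=; apply: eq_bigr => i _; apply: eq_bigr => j _.
by rewrite eq_sym.
Qed.

Let prod_rev (s : seq 'I_m) : sorted ltn (map val s) ->
  let S := [set i in s]%SET in
  \prod_(i <- rev s) cl_e i = ls S S *: cl_basis S :> clifford R m.
Proof.
elim: s => [_|i s IH /path_cons[ss is_]] /=.
  have -> : [set k in [::]]%SET = finset.set0 :> {set 'I_m}.
    by apply/setP => x; rewrite !inE.
  by rewrite big_nil /ls big_set0 scale1r cl_basis0.
rewrite rev_cons -cats1 big_cat big_seq1 IH //= -scalerAl /cl_e cl_basisM scalerA.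
rewrite symdiffC symdiff_cons //; congr (_ *: _).
rewrite -symdiff_cons // lsDl !lsDr signE.
set S := [set k in s]%SET.
have -> : ls [set i]%SET [set i]%SET = 1 by rewrite /ls !big_set1 ltnn.
have -> : ls [set i]%SET S = 1.
  rewrite /ls big_set1 big1 // => j /is_ ij.
  by rewrite ltnNge (ltnW ij).
have -> : ds S [set i]%SET = 1.
  rewrite /ds big1 // => j /is_ ij; rewrite big_set1.
  by case: eqP ij => // ->; rewrite ltnn.
by rewrite !mulr1 !mul1r mulrC.
Qed.

Let rev_prodE A :
  \prod_(i <- rev (enum A)) cl_e i = ls A A *: cl_basis A :> clifford R m.
Proof.
have := prod_rev (sorted_enum A) => /= ->.
by have -> : [set i in enum A]%SET = A by apply/setP => x; rewrite inE mem_enum.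
Qed.

Lemma cl_reversion_is_linear : linear (@cl_reversion R m).
Proof.
move=> k a b; rewrite /cl_reversion scaler_sumr -big_split /=.
by apply: eq_bigr => A _; rewrite ffunE cl_coefZ scalerDl scalerA.
Qed.

HB.instance Definition _ :=
  GRing.isLinear.Build R (clifford R m) (clifford R m) *:%R
    (@cl_reversion R m) cl_reversion_is_linear.

Let rev_basis A : cl_reversion (cl_basis A) = ls A A *: cl_basis A :> clifford R m.
Proof.
rewrite /cl_reversion (bigD1 A) //= [X in _ + X]big1 ?addr0.
  by rewrite ffunE eqxx scale1r rev_prodE.
by move=> B /negPf BA; rewrite ffunE BA scale0r.
Qed.

Lemma cl_reversion_e (i : 'I_m) : cl_reversion (cl_e i) = cl_e i :> clifford R m.
Proof. by rewrite /cl_e rev_basis /ls !big_set1 ltnn scale1r. Qed.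

Lemma cl_reversion1 : cl_reversion 1 = 1 :> clifford R m.
Proof. by rewrite -cl_basis0 rev_basis /ls big_set0 scale1r. Qed.

Lemma cl_reversionM a b :
  cl_reversion (a * b) = cl_reversion b * cl_reversion a.
Proof.
rewrite (cl_expand a) (cl_expand b) mulr_suml !linear_sum mulr_sumr /=.
apply: eq_bigr => A _; rewrite mulr_sumr mulr_suml linear_sum /=.
apply: eq_bigr => B _.
rewrite -scalerAl -scalerAr !linearZ /= -scalerAl -scalerAr.
rewrite scalerA [RHS]scalerA [a A * _]mulrC; congr (_ *: _).
rewrite cl_basisM linearZ /= !rev_basis -scalerAl -scalerAr cl_basisM !scalerA.
rewrite (symdiffC B); congr (_ *: _).
rewrite lsDl !lsDr !signE (dsC B); ring: (lsK A B).
Qed.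

End CliffordTheory.

Definition structural_set {R : realType} {m : nat} (psi : m.-tuple 'rV[R]_m) :
    Prop :=
  basis_of fullv psi /\
  forall i j : 'I_m,
    \sum_(k < m) tnth psi i ord0 k * tnth psi j ord0 k = (i == j)%:R.

Section Psi.
Context {R : realType} {m : nat}.
Implicit Types (phi psi : m.-tuple 'rV[R]_m) (a : clifford R m).

(* psi_A: [enum A] lists A in increasing order. *)
Definition str_prod psi (A : {set 'I_m}) : clifford R m :=
  \prod_(j <- enum A) cl_vec (tnth psi j).

Definition Psi phi psi (k : nat) a : clifford R m :=
  if k is 0%N then a
  else \sum_(A : {set 'I_m} | #|A| == k)
         str_prod phi A * a * cl_reversion (str_prod psi A).

Definition Psi_plus phi psi a : clifford R m :=
  \sum_(k < m.+1 | ~~ odd k) Psi phi psi k a.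

Definition Psi_minus phi psi a : clifford R m :=
  \sum_(k < m.+1 | odd k) Psi phi psi k a.

End Psi.

(* Functions on Omega are represented by total functions; as Omega is open in
   all uses, the derivatives at points of Omega only depend on the restriction
   to Omega. *)

Section Functions.
Context {R : realType} {m : nat}.
Implicit Types (f : 'rV[R]_m -> clifford R m) (Omega : set 'rV[R]_m).

Definition pd (i : 'I_m) (g : 'rV[R]_m -> R) : 'rV[R]_m -> R :=
  fun x => 'D_(delta_mx ord0 i) g x.

Definition has_pd (i : 'I_m) (g : 'rV[R]_m -> R) (x : 'rV[R]_m) : Prop :=
  derivable g x (delta_mx ord0 i).

Definition C2_scalar_on Omega (g : 'rV[R]_m -> R) : Prop :=
  forall x, Omega x ->
    {for x, continuous g} /\
    forall i, has_pd i g x /\ {for x, continuous (pd i g)} /\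
      forall j, has_pd j (pd i g) x /\ {for x, continuous (pd j (pd i g))}.

Definition C2_on Omega f : Prop :=
  forall A : {set 'I_m}, C2_scalar_on Omega (fun x => f x A).

Definition cl_pd (i : 'I_m) f : 'rV[R]_m -> clifford R m :=
  fun x => [ffun A => pd i (fun y => f y A) x].

Definition laplacian f : 'rV[R]_m -> clifford R m :=
  fun x => \sum_(i < m) cl_pd i (cl_pd i f) x.

Definition harmonic_on Omega f : Prop :=
  C2_on Omega f /\ forall x, Omega x -> laplacian f x = 0.

Definition sandwich_dirac (phi psi : m.-tuple 'rV[R]_m) f :
    'rV[R]_m -> clifford R m :=
  fun x => \sum_(i < m) \sum_(j < m)
    cl_vec (tnth phi i) * cl_pd i (cl_pd j f) x * cl_vec (tnth psi j).

Definition inframonogenic_on (phi psi : m.-tuple 'rV[R]_m) Omega f : Prop :=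
  C2_on Omega f /\ forall x, Omega x -> sandwich_dirac phi psi f x = 0.

End Functions.

(* Main.v *)
From HB Require Import structures.
Require Import Defs.
From mathcomp Require Import all_boot all_order all_algebra.
From mathcomp Require Import all_classical all_reals all_analysis.
From mathcomp Require Import ring.
Import numFieldNormedType.Exports.
Local Open Scope classical_set_scope.
Local Open Scope ring_scope.

Set Implicit Arguments.
Unset Strict Implicit.
Unset Printing Implicit Defensive.

Import Order.TTheory GRing.Theory Num.Theory.

(** Write T_i for the two-sided multiplication a |-> phi_i a psi_i.  The T_i
    commute, because exchanging i and j changes the sign on both sides at once,
    and they are involutions, because phi_i ^+ 2 = psi_i ^+ 2 = -1.  Reversion
    puts the factors of psi_A in the order which makes the summand
    phi_A a rev(psi_A) the composite of the T_i with i in A; hence Psi_k is the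
    k-th elementary symmetric function of the T_i.  Composing with T_i adds i to
    A or removes it, so T_i exchanges Psi_plus and Psi_minus
    ([sandwich_Psi_parity]).  Both are treated together as [Psi_parity], indexed
    by the parity of #|A|.

    Multiplying T_j Psi_plus = Psi_minus on the left by phi_j gives
    Psi_plus(a) psi_j = - phi_j Psi_minus(a), hence
      phi_i Psi_plus(a) psi_j = - phi_i phi_j Psi_minus(a),
    and the same holds with the two parities exchanged.  The factor phi_i phi_j
    is antisymmetric for i != j, while the second derivatives of a C^2 function
    are symmetric; in the sum over i and j only the diagonal survives, and it
    equals Psi_minus(Delta f) = 0 ([sum_sandwich_symmetric]).

    On the analytic side, this needs that second partial derivatives commute
    ([derive_comm], by applying the mean value theorem twice to a second
    difference) and that linear maps with constant coefficients commute with
    second partial derivatives of C^2 functions ([cl_pd2_linear]); the latter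
    also gives the harmonicity of Psi_plus(f) and Psi_minus(f). *)

(** * Products of commuting involutions *)

Section CommutingInvolutions.
Variables (I : finType) (V : Type) (T : I -> V -> V).
Hypothesis T_comm : forall i j a, T i (T j a) = T j (T i a).
Hypothesis T_invol : forall i a, T i (T i a) = a.

Lemma foldr_comm i s a : T i (foldr T a s) = foldr T (T i a) s.
Proof. by elim: s => //= j s IH; rewrite T_comm IH. Qed.

(** The enumeration of a set with one more element inserts it at an arbitrary
    place, so composites have to be independent of the order of the factors. *)
Lemma perm_foldr_comm s t a : perm_eq s t -> foldr T a s = foldr T a t.
Proof.
apply: catCA_perm_subst => s1 s2 s3; rewrite !foldr_cat.
elim: s1 (foldr T a s3) => [//|i s1 IH] b /=.
by rewrite IH foldr_comm.
Qed.

(** If i is in A, its factor cancels against the extra T i by involutivity;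
    otherwise a new factor appears. *)
Lemma foldr_enum_symdiff i (A : {set I}) a :
  T i (foldr T a (enum A)) = foldr T a (enum (symdiff [set i]%SET A)).
Proof.
have insert (B : {set I}) : i \notin B ->
    foldr T a (enum (symdiff [set i]%SET B)) = T i (foldr T a (enum B)).
  move=> iB; rewrite -[RHS]/(foldr T a (i :: enum B)).
  apply: perm_foldr_comm; apply: uniq_perm; rewrite ?enum_uniq //=.
    by rewrite mem_enum iB enum_uniq.
  move=> x; rewrite !inE !mem_enum in_symdiff inE.
  by case: eqP => // ->; rewrite (negPf iB).
have [iA|/insert -> //] := boolP (i \in A).
(* When i is in A, insert i into the set without it, whose symmetric difference
   with {i} is A. *)
rewrite -{1}(symdiffK [set i]%SET A) insert ?T_invol //.
by rewrite in_symdiff inE eqxx iA.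
Qed.

End CommutingInvolutions.

Lemma odd_card_symdiff1 (I : finType) (i : I) (A : {set I}) :
  odd #|symdiff [set i]%SET A| = ~~ odd #|A|.
Proof.
have insert (B : {set I}) : i \notin B -> odd #|symdiff [set i]%SET B| = ~~ odd #|B|.
  move=> iB; rewrite -[RHS]/(odd #|B|.+1) -[#|B|.+1]/(true + #|B|)%N -iB -cardsU1.
  congr (odd _); apply: eq_card => x; rewrite in_symdiff !inE.
  by case: eqP => // ->; rewrite (negPf iB).
have [iA|/insert //] := boolP (i \in A).
rewrite -[in RHS](symdiffK [set i]%SET A) [in RHS]insert ?negbK //.
by rewrite in_symdiff inE eqxx iA.
Qed.

(** * Anticommutation relations of vectors *)

Section Vectors.
Variables (R : comNzRingType) (m : nat).
Implicit Types v w : 'rV[R]_m.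

Lemma cl_vec_anticomm v w :
  cl_vec v * cl_vec w + cl_vec w * cl_vec v =
  (- 2 * \sum_(k < m) v ord0 k * w ord0 k)%:A.
Proof.
rewrite /cl_vec !mulr_suml.
under eq_bigr do rewrite mulr_sumr.
under [X in _ + X]eq_bigr do rewrite mulr_sumr.
rewrite [X in _ + X]exchange_big -big_split /= mulr_sumr scaler_suml.
apply: eq_bigr => k _; rewrite -big_split /= (bigD1 k) //= big1 ?addr0.
  rewrite -!scalerAl -!scalerAr !scalerA [w _ _ * _]mulrC -scalerDr.
  by rewrite cl_e_anticomm eqxx mulr1 scalerA mulrC.
move=> j jk; rewrite -!scalerAl -!scalerAr !scalerA [w _ _ * _]mulrC -scalerDr.
by rewrite cl_e_anticomm eq_sym (negPf jk) mulr0 scale0r scaler0.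
Qed.

Lemma cl_reversion_vec v : cl_reversion (cl_vec v) = cl_vec v.
Proof.
rewrite /cl_vec linear_sum; apply: eq_bigr => i _.
by rewrite linearZ /= cl_reversion_e.
Qed.

End Vectors.

(** * The operators Psi of a fixed parity *)

Section StructuralSets.
Variables (R : realType) (m : nat).
Implicit Types (phi psi : m.-tuple 'rV[R]_m) (a : clifford R m).

Lemma structural_sqr psi i : structural_set psi ->
  cl_vec (tnth psi i) * cl_vec (tnth psi i) = -1.
Proof.
case=> _ orth; have := cl_vec_anticomm (tnth psi i) (tnth psi i).
rewrite orth eqxx mulr1 -mulr2n => /(congr1 (fun x => (2^-1 : R) *: x)).
rewrite -[_ * _ *+ 2](@scaler_nat R) !scalerA mulrN mulVf ?pnatr_eq0 //.
by rewrite scale1r scaleN1r.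
Qed.

Lemma structural_anticomm psi i j : structural_set psi -> i != j ->
  cl_vec (tnth psi j) * cl_vec (tnth psi i) =
  - (cl_vec (tnth psi i) * cl_vec (tnth psi j)).
Proof.
case=> _ orth /negPf ij; have := cl_vec_anticomm (tnth psi j) (tnth psi i).
by rewrite orth eq_sym ij mulr0 scale0r => /eqP; rewrite addr_eq0 => /eqP.
Qed.

Definition sandwich phi psi (i : 'I_m) a : clifford R m :=
  cl_vec (tnth phi i) * a * cl_vec (tnth psi i).

Definition Psi_parity phi psi (b : bool) a : clifford R m :=
  \sum_(A : {set 'I_m} | odd #|A| == b)
    str_prod phi A * a * cl_reversion (str_prod psi A).

Lemma sandwich_sum phi psi (J : Type) (r : seq J) (P : pred J) (F : J -> clifford R m) i :
  sandwich phi psi i (\sum_(j <- r | P j) F j) =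
  \sum_(j <- r | P j) sandwich phi psi i (F j).
Proof.
rewrite /sandwich; move: (cl_vec _) (cl_vec _) => p q.
by rewrite mulr_sumr mulr_suml.
Qed.

Lemma sandwich_comm phi psi i j a : structural_set phi -> structural_set psi ->
  sandwich phi psi i (sandwich phi psi j a) =
  sandwich phi psi j (sandwich phi psi i a).
Proof.
move=> sphi spsi; have [->//|ij] := eqVneq i j.
rewrite /sandwich !mulrA -!(mulrA (_ * a)).
rewrite (structural_anticomm sphi ij) (structural_anticomm spsi ij).
by rewrite mulrN !mulNr.
Qed.

Lemma sandwich_invol phi psi i a : structural_set phi -> structural_set psi ->
  sandwich phi psi i (sandwich phi psi i a) = a.
Proof.
move=> sphi spsi; rewrite /sandwich !mulrA -!(mulrA (_ * a)).
by rewrite !structural_sqr // mulN1r mulrN1 opprK.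
Qed.

(** Reversion moves the first factor of psi_A to the far right, so that peeling
    off the smallest index of A peels off one two-sided multiplication. *)
Lemma str_prod_sandwich phi psi (A : {set 'I_m}) a :
  str_prod phi A * a * cl_reversion (str_prod psi A) =
  foldr (sandwich phi psi) a (enum A).
Proof.
rewrite /str_prod; elim: (enum A) => [|i s IH].
  by rewrite !big_nil cl_reversion1 mul1r mulr1.
rewrite !big_cons cl_reversionM cl_reversion_vec /= -IH /sandwich.
by rewrite !mulrA.
Qed.

(** Toggling the membership of i permutes the subsets and reverses the parity
    of their cardinals. *)
Lemma sandwich_Psi_parity phi psi b i a : structural_set phi -> structural_set psi ->
  sandwich phi psi i (Psi_parity phi psi b a) = Psi_parity phi psi (~~ b) a.
Proof.
move=> sphi spsi; rewrite /Psi_parity sandwich_sum.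
rewrite [RHS](reindex_inj (can_inj (symdiffK [set i]%SET))) /=.
apply: eq_big => A; first by rewrite odd_card_symdiff1 (inj_eq negb_inj).
move=> _; rewrite !str_prod_sandwich foldr_enum_symdiff // => *.
  exact: sandwich_comm.
exact: sandwich_invol.
Qed.

(** A right multiplication by psi_j is traded for a left multiplication by
    phi_j; this turns two-sided expressions into one-sided ones. *)
Lemma Psi_parity_mulr phi psi b j a : structural_set phi -> structural_set psi ->
  Psi_parity phi psi b a * cl_vec (tnth psi j) =
  - (cl_vec (tnth phi j) * Psi_parity phi psi (~~ b) a).
Proof.
move=> sphi spsi; rewrite -(sandwich_Psi_parity b j a sphi spsi) /sandwich.
by rewrite !mulrA structural_sqr // !mulN1r mulNr opprK.
Qed.

(** For k = 0 the only summand is that of the empty set, which is a itself. *)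
Lemma Psi_sum phi psi k a :
  Psi phi psi k a = \sum_(A : {set 'I_m} | #|A| == k)
    str_prod phi A * a * cl_reversion (str_prod psi A).
Proof.
case: k => [|k] //=; rewrite (eq_bigl (pred1 finset.set0)) => [|A]; last exact: cards_eq0.
by rewrite big_pred1_eq str_prod_sandwich enum_set0.
Qed.

(** The subsets of a given parity are grouped by cardinal, which is at most m. *)
Lemma sum_Psi_parity phi psi b a :
  \sum_(k < m.+1 | odd k == b) Psi phi psi k a = Psi_parity phi psi b a.
Proof.
have cardA (A : {set 'I_m}) : (#|A| < m.+1)%N by rewrite ltnS -[leqRHS]card_ord max_card.
rewrite /Psi_parity [RHS](partition_big (fun A : {set 'I_m} => inord #|A| : 'I_m.+1)
  (fun k : 'I_m.+1 => odd k == b)) /=; last by move=> A; rewrite inordK.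
apply: eq_bigr => k kb; rewrite Psi_sum; apply: eq_bigl => A.
rewrite -val_eqE /= inordK //.
by case: (#|A| =P k) => [->|]; rewrite ?kb ?andbF.
Qed.

Lemma Psi_plusE phi psi a : Psi_plus phi psi a = Psi_parity phi psi false a.
Proof. by rewrite -sum_Psi_parity; apply: eq_bigl => k; case: (odd k). Qed.

Lemma Psi_minusE phi psi a : Psi_minus phi psi a = Psi_parity phi psi true a.
Proof. by rewrite -sum_Psi_parity; apply: eq_bigl => k; case: (odd k). Qed.

Lemma Psi_parity_is_linear phi psi b : linear (Psi_parity phi psi b).
Proof.
move=> k x y; rewrite /Psi_parity scaler_sumr -big_split /=.
apply: eq_bigr => A _.
by rewrite mulrDr mulrDl -scalerAr -scalerAl.
Qed.

HB.instance Definition _ phi psi b :=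
  GRing.isLinear.Build R (clifford R m) (clifford R m) *:%R
    (Psi_parity phi psi b) (Psi_parity_is_linear phi psi b).

(** The algebraic core: d stands for the Hessian of f at a point.  After moving
    psi_j to the left, the sum is - \sum_i \sum_j phi_i phi_j G i j with G
    symmetric of trace zero, and only the squares phi_i ^+ 2 = -1 contribute. *)
Lemma sum_sandwich_symmetric phi psi b (d : 'I_m -> 'I_m -> clifford R m) :
  structural_set phi -> structural_set psi ->
  (forall i j, d i j = d j i) -> \sum_i d i i = 0 ->
  \sum_i \sum_j cl_vec (tnth phi i) * Psi_parity phi psi b (d i j)
                * cl_vec (tnth psi j) = 0.
Proof.
move=> sphi spsi dC d0.
pose u i := cl_vec (tnth phi i); pose G i j := Psi_parity phi psi (~~ b) (d i j).
under eq_bigr do under eq_bigr do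
  rewrite -mulrA Psi_parity_mulr // mulrN mulrA -/(u _) -/(u _) -/(G _ _).
have GC i j : G i j = G j i by rewrite /G dC.
have trG : \sum_i G i i = 0 by rewrite -linear_sum d0 linear0.
(* Adding the sum to its transpose makes the off-diagonal terms cancel in
   pairs. *)
set S := \sum_i _.
suff : S + S = 0.
  rewrite -mulr2n -(@scaler_nat R) => /eqP; rewrite scaler_eq0 pnatr_eq0 /=.
  by move/eqP.
rewrite {2}/S exchange_big /= -big_split /=.
rewrite -[RHS](scaler0 _ (2 : R)) -[in RHS]trG scaler_sumr.
apply: eq_bigr => i _; rewrite -big_split /= (bigD1 i) //= big1.
  by rewrite /u structural_sqr // addr0 mulN1r opprK scaler_nat mulr2n.
move=> j ji; rewrite (GC j i) -opprD -mulrDl.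
by rewrite /u (structural_anticomm sphi ji) addNr mul0r oppr0.
Qed.

End StructuralSets.

(** * Symmetry of second derivatives *)

Section SecondDerivatives.
Variables (R : realType) (V : normedModType R).
Implicit Types (g : V -> R) (x u v : V).

Lemma is_derive_line g x u (s : R) : derivable g (x + s *: u) u ->
  is_derive s 1 (fun t : R => g (x + t *: u)) ('D_u g (x + s *: u)).
Proof.
move=> dg.
have E : (fun h : R => h^-1 *: (((fun t : R => g (x + t *: u)) \o shift s) (h *: 1) -
            g (x + s *: u))) =
         (fun h : R => h^-1 *: ((g \o shift (x + s *: u)) (h *: u) - g (x + s *: u))).
  apply/funext => h /=; do 3 congr (_ _).
  by rewrite [h *: 1]mulr1 scalerDl addrCA.
apply: DeriveDef; first by rewrite /derivable E.
by rewrite /derive E.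
Qed.

Lemma is_derive_translate g a x u : derivable g (x + a) u ->
  is_derive x u (g \o shift a) ('D_u g (x + a)).
Proof.
move=> dg.
have E : (fun h : R => h^-1 *: (((g \o shift a) \o shift x) (h *: u) - (g \o shift a) x)) =
         (fun h : R => h^-1 *: ((g \o shift (x + a)) (h *: u) - g (x + a))).
  by apply/funext => h /=; rewrite addrA.
apply: DeriveDef; first by rewrite /derivable E.
by rewrite /derive E.
Qed.

Lemma MVT_line g x u (h : R) : 0 < h ->
  (forall s, 0 <= s <= h -> derivable g (x + s *: u) u) ->
  exists2 s, 0 <= s <= h & g (x + h *: u) - g x = h * 'D_u g (x + s *: u).
Proof.
move=> h0 dg; pose G (t : R) := g (x + t *: u).
have [||| s sh E] := @MVT R G (fun t => 'D_u g (x + t *: u)) 0 h.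
- by [].
- move=> s; rewrite in_itv /= => /andP[s0 s1].
  by apply: is_derive_line; apply: dg; rewrite !ltW.
- apply: derivable_within_continuous => s; rewrite in_itv /= => sh.
  by have [] := is_derive_line (dg _ sh).
move: sh; rewrite in_itv /= => /andP[s0 s1]; exists s; first by rewrite !ltW.
by move: E; rewrite /G scale0r addr0 subr0 mulrC.
Qed.

(** The mean value theorem is applied first in direction u to the increment
    y |-> g (y + h v) - g y, and then in direction v to the derivative 'D_u g. *)
Lemma second_difference g x u v (h : R) : 0 < h ->
  (forall s t, 0 <= s <= h -> 0 <= t <= h ->
     derivable g (x + s *: u + t *: v) u /\
     derivable ('D_u g) (x + s *: u + t *: v) v) ->
  exists s t, [/\ 0 <= s <= h, 0 <= t <= h &
    g (x + h *: u + h *: v) - g (x + h *: u) - (g (x + h *: v) - g x) =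
    h ^+ 2 * 'D_v ('D_u g) (x + s *: u + t *: v)].
Proof.
move=> h0 dg; have h00 : 0 <= (0 : R) <= h by rewrite lexx ltW.
have h0h : 0 <= h <= h by rewrite lexx ltW.
pose k := (g \o shift (h *: v)) - g.
have dk s : 0 <= s <= h -> is_derive (x + s *: u) u k
    ('D_u g (x + s *: u + h *: v) - 'D_u g (x + s *: u)).
  move=> sh; apply: is_deriveB.
    by have [d _] := dg s h sh h0h; apply: is_derive_translate.
  have [] := dg s 0 sh h00; rewrite scale0r addr0 => d _.
  exact: derivableP.
have [s sh E] := @MVT_line k x u h h0 (fun s sh => @ex_derive _ _ _ _ _ _ _ (dk s sh)).
have [|t th E'] := @MVT_line ('D_u g) (x + s *: u) v h h0.
  by move=> t th; have [] := dg s t sh th.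
exists s, t; split=> //; rewrite expr2 -mulrA -E'.
have [_ <-] := dk s sh.
by rewrite -E.
Qed.

(** Schwarz's theorem on mixed derivatives.  The second difference of g over
    the parallelogram spanned by h u and h v is symmetric in u and v; divided by
    h ^+ 2, it is a value of each mixed derivative at some point close to x, and
    both mixed derivatives are continuous at x. *)
Lemma derive_comm g x u v :
  (\forall y \near x, [/\ derivable g y u, derivable g y v,
      derivable ('D_u g) y v & derivable ('D_v g) y u]) ->
  {for x, continuous ('D_v ('D_u g))} -> {for x, continuous ('D_u ('D_v g))} ->
  'D_v ('D_u g) x = 'D_u ('D_v g) x.
Proof.
have swap (a b c d : R) : a - b - (c - d) = a - c - (b - d) by ring.
(* Here a and b stand for the mixed derivatives at x, and c and d for their
   values at the intermediate points. *)
have close (a b c d e h : R) : h != 0 -> `|a - c| < e / 2 -> `|b - d| < e / 2 ->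
    h ^+ 2 * c = h ^+ 2 * d -> `|a - b| <= e.
  move=> hn0 ac bd /mulfI cd; rewrite [leRHS]splitr.
  apply: (le_trans (ler_distD c _ _)); apply: lerD; first exact: ltW ac.
  by rewrite cd ?expf_neq0 // distrC ltW.
move=> dg cvu cuv; apply/eqP; rewrite -subr_eq0 -normr_le0.
suff le_eps (e : R) : 0 < e -> `|'D_v ('D_u g) x - 'D_u ('D_v g) x| <= e.
  by apply/ler_addgt0Pl => e /le_eps; rewrite addr0.
move=> e0; have e2 : 0 < e / 2 by rewrite divr_gt0.
have /cvgrPdist_lt/(_ _ e2) nvu := cvu.
have /cvgrPdist_lt/(_ _ e2) nuv := cuv.
have [r /= r0 br] := (nbhs_ballP _ _).1 (@filterI _ _ _ _ _ dg
  (@filterI _ _ _ _ _ nvu nuv)).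
(* With this h the whole parallelogram lies in the ball of radius r; the term 1
   keeps the inequality strict and the denominator nonzero. *)
pose h := r / (`|u| + `|v| + 1).
have c0 : 0 < `|u| + `|v| + 1 by rewrite ltr_wpDl ?addr_ge0.
have h0 : 0 < h by rewrite divr_gt0.
have bx s t : 0 <= s <= h -> 0 <= t <= h -> ball x r (x + s *: u + t *: v).
  move=> /andP[s0 sh] /andP[t0 th].
  rewrite -ball_normE /= -addrA opprD addNKr normrN.
  apply: (le_lt_trans (ler_normD _ _)); rewrite !normrZ !ger0_norm //.
  apply: (@le_lt_trans _ _ (h * (`|u| + `|v|))).
    by rewrite mulrDr lerD // ler_wpM2r.
  rewrite /h mulrAC ltr_pdivrMr // ltr_pM2l //.
  by rewrite ltrDl.
have [s [t [sh th E]]] := @second_difference g x u v h h0 (fun s t sh th =>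
  let: conj (And4 a _ b _) _ := br _ (bx s t sh th) in conj a b).
have bx' s' t' (sh' : 0 <= s' <= h) (th' : 0 <= t' <= h) :
  ball x r (x + s' *: v + t' *: u) by rewrite addrAC; apply: bx.
have [s' [t' [sh' th' E']]] := @second_difference g x v u h h0 (fun s t sh th =>
  let: conj (And4 _ a _ b) _ := br _ (bx' s t sh th) in conj a b).
have [_ [A _]] := br _ (bx _ _ sh th).
have [_ [_ B]] := br _ (bx' _ _ sh' th').
apply: (close _ _ _ _ _ h _ A B); first by rewrite gt_eqF.
apply: etrans (esym E) (etrans _ E').
by rewrite [x + h *: v + _]addrAC; apply: swap.
Qed.

End SecondDerivatives.

(** * C^2 functions and constant linear maps *)

Lemma near_eq_continuous (T U : topologicalType) (f g : T -> U) (x : T) :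
  (\forall y \near x, f y = g y) -> {for x, continuous f} -> {for x, continuous g}.
Proof.
move=> fg cf; rewrite /prop_for /continuous_at -(nbhs_singleton fg).
by apply: cvg_trans cf; apply: near_eq_cvg.
Qed.

Section LinearCombinations.
Variables (R : realType) (J : finType) (c : J -> R).

Definition lincomb (T : Type) (h : J -> T -> R) : T -> R :=
  fun y => \sum_B c B * h B y.

Lemma is_derive_lincomb (V : normedModType R) (h : J -> V -> R) (dh : J -> R) x v :
  (forall B, is_derive x v (h B) (dh B)) ->
  is_derive x v (lincomb h) (\sum_B c B * dh B).
Proof.
move=> dhB; rewrite /lincomb -(fct_sumE _ _ (fun B y => c B * h B y)).
elim/big_ind2 : _ => [|f df g dg fd gd|B _]; first exact: is_derive_cst.
  exact: is_deriveD.
exact: is_deriveZ.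
Qed.

Lemma continuous_lincomb (T : topologicalType) (h : J -> T -> R) (x : T) :
  (forall B, {for x, continuous (h B)}) -> {for x, continuous (lincomb h)}.
Proof.
move=> ch; apply: cvg_big => [|B _]; first exact: add_continuous.
by apply: cvgM; [exact: cvg_cst|exact: ch].
Qed.

Variables (m : nat) (Omega : set 'rV[R]_m) (h : J -> 'rV[R]_m -> R).
Hypotheses (openO : open Omega) (C2h : forall B, C2_scalar_on Omega (h B)).

Lemma is_derive_lincomb1 i x : Omega x ->
  is_derive x (delta_mx ord0 i) (lincomb h) (lincomb (fun B => pd i (h B)) x).
Proof.
move=> Ox; apply: is_derive_lincomb => B; apply: derivableP.
by have [_ /(_ i)[]] := C2h B Ox.
Qed.

(** The first derivatives of the combination are known only on Omega, so the
    second ones are computed from an equality of germs. *)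
Lemma is_derive_lincomb2 i j x : Omega x ->
  is_derive x (delta_mx ord0 j) (pd i (lincomb h))
    (lincomb (fun B => pd j (pd i (h B))) x).
Proof.
move=> Ox; apply: (@near_eq_is_derive _ _ _ (lincomb (fun B => pd i (h B)))).
  apply: filterS (open_nbhs_nbhs (conj openO Ox)) => y Oy.
  by have [_ <-] := is_derive_lincomb1 i Oy.
apply: is_derive_lincomb => B; apply: derivableP.
by have [_ /(_ i)[_ [_ /(_ j)[]]]] := C2h B Ox.
Qed.

Lemma pd2_lincomb i j x : Omega x ->
  pd j (pd i (lincomb h)) x = lincomb (fun B => pd j (pd i (h B))) x.
Proof. by move=> Ox; have [_ <-] := is_derive_lincomb2 i j Ox. Qed.

Lemma C2_lincomb : C2_scalar_on Omega (lincomb h).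
Proof.
move=> x Ox; split.
  by apply: continuous_lincomb => B; have [] := C2h B Ox.
have nO : \forall y \near x, Omega y by exact: open_nbhs_nbhs.
move=> i; split; first by have [] := is_derive_lincomb1 i Ox.
split.
  apply: near_eq_continuous (continuous_lincomb (h := fun B => pd i (h B)) _).
    by apply: filterS nO => y Oy; have [_ <-] := is_derive_lincomb1 i Oy.
  by move=> B; have [_ /(_ i)[_ []]] := C2h B Ox.
move=> j; split; first by have [] := is_derive_lincomb2 i j Ox.
apply: near_eq_continuous (continuous_lincomb (h := fun B => pd j (pd i (h B))) _).
  by apply: filterS nO => y Oy; rewrite pd2_lincomb.
by move=> B; have [_ /(_ i)[_ [_ /(_ j)[]]]] := C2h B Ox.
Qed.

End LinearCombinations.

Section CliffordFunctions.
Variables (R : realType) (m : nat) (Omega : set 'rV[R]_m).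
Variable f : 'rV[R]_m -> clifford R m.
Hypotheses (openO : open Omega) (C2f : C2_on Omega f).

Lemma cl_pd2E i j (g : 'rV[R]_m -> clifford R m) x A :
  cl_pd j (cl_pd i g) x A = pd j (pd i (fun y => g y A)) x.
Proof.
by rewrite ffunE; congr (pd j _ x); apply/funext => y; rewrite ffunE.
Qed.

Lemma cl_pd2C i j x : Omega x -> cl_pd j (cl_pd i f) x = cl_pd i (cl_pd j f) x.
Proof.
move=> Ox. apply/ffunP => A.
apply: etrans (cl_pd2E i j f x A) (etrans _ (esym (cl_pd2E j i f x A))).
apply: (@derive_comm _ _ (fun y => f y A)
  x (delta_mx ord0 i) (delta_mx ord0 j)).
- apply: filterS (open_nbhs_nbhs (conj openO Ox)) => y Oy.
  have [_ d] := C2f A Oy; have [di [_ /(_ j)[dij _]]] := d i.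
  have [dj [_ /(_ i)[dji _]]] := d j. exact: And4 di dj dij dji.
- by have [_ /(_ i)[_ [_ /(_ j)[]]]] := C2f A Ox.
- by have [_ /(_ j)[_ [_ /(_ i)[]]]] := C2f A Ox.
Qed.

Variable L : {linear clifford R m -> clifford R m}.

(** In coordinates, a linear map is a family of linear combinations with
    constant coefficients, so that the results on scalar functions apply. *)
Lemma linear_coef a A : L a A = \sum_B L (cl_basis B) A * a B.
Proof.
rewrite {1}(cl_expand a) linear_sum sum_ffunE; apply: eq_bigr => B _.
by rewrite linearZ /= cl_coefZ mulrC.
Qed.

Lemma linear_comp_coef A : (fun y => L (f y) A) =
  lincomb (fun B => L (cl_basis B) A) (fun B y => f y B).
Proof. by apply/funext => y; rewrite linear_coef. Qed.

Lemma C2_linear : C2_on Omega (fun y => L (f y)).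
Proof. by move=> A; rewrite linear_comp_coef; apply: C2_lincomb. Qed.

Lemma cl_pd2_linear i j x : Omega x ->
  cl_pd j (cl_pd i (fun y => L (f y))) x = L (cl_pd j (cl_pd i f) x).
Proof.
move=> Ox; apply/ffunP => A.
apply: etrans (cl_pd2E i j _ x A) _; rewrite linear_comp_coef.
apply: etrans (pd2_lincomb _ openO C2f i j Ox) _; rewrite linear_coef.
by apply: eq_bigr => B _; rewrite -(cl_pd2E i j f x B).
Qed.

End CliffordFunctions.

(** * Preservation of harmonicity and the inframonogenic equation *)

(** The symmetric array in [sum_sandwich_symmetric] is the Hessian of f at x,
    whose trace is the Laplacian. *)
Lemma Psi_parity_harmonic_inframonogenic (R : realType) (m : nat)
    (phi psi : m.-tuple 'rV[R]_m) (Omega : set 'rV[R]_m)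
    (f : 'rV[R]_m -> clifford R m) (b : bool) :
  structural_set phi -> structural_set psi -> open Omega ->
  harmonic_on Omega f ->
  harmonic_on Omega (fun x => Psi_parity phi psi b (f x)) /\
  inframonogenic_on phi psi Omega (fun x => Psi_parity phi psi b (f x)).
Proof.
move=> sphi spsi openO [C2f hf].
have C2Pf : C2_on Omega (fun x => Psi_parity phi psi b (f x)) by exact: C2_linear.
split; split; [exact: C2Pf|move=> x Ox|exact: C2Pf|move=> x Ox].
  rewrite /laplacian; under eq_bigr do rewrite (cl_pd2_linear openO C2f) //.
  by rewrite -linear_sum -/(laplacian f x) hf // linear0.
rewrite /sandwich_dirac.
under eq_bigr do under eq_bigr do rewrite (cl_pd2_linear openO C2f) //.
apply: (sum_sandwich_symmetric b sphi spsi) => [i j|]; last exact: hf.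
exact: (cl_pd2C openO C2f).
Qed.

Theorem theorem3p2 (R : realType) (m : nat) (phi psi : m.-tuple 'rV[R]_m)
    (Omega : set 'rV[R]_m) (f : 'rV[R]_m -> clifford R m) :
  structural_set phi -> structural_set psi ->
  open Omega -> connected Omega ->
  harmonic_on Omega f ->
  let fplus := fun x => Psi_plus phi psi (f x) in
  let fminus := fun x => Psi_minus phi psi (f x) in
  (harmonic_on Omega fplus /\ inframonogenic_on phi psi Omega fplus) /\
  (harmonic_on Omega fminus /\ inframonogenic_on phi psi Omega fminus).
Proof.
move=> sphi spsi openO _ hf /=.
have -> : Psi_plus phi psi = Psi_parity phi psi false.
  by apply/funext => a; rewrite Psi_plusE.
have -> : Psi_minus phi psi = Psi_parity phi psi true.
  by apply/funext => a; rewrite Psi_minusE.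
by split; apply: Psi_parity_harmonic_inframonogenic.
Qed.
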